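(* Let $k\ge 2$ and let $\mathcal{H}$ be a finite $k$-uniform hypergraph satisfying all of the following: (i) $\mathcal{H}$ has a vertex $z$ of degree $2$; (ii) $\delta(\mathcal{H} \setminus \{z\}) \geq 3$ and $d_{\mathcal H}(u) \geq 4$ for every $u \in V(\mathcal{H}) \setminus \{z\}$; (iii) $\mathcal{H} \setminus \{z\}$ has a fast winning strategy; (iv) for every two edges $e, e' \in E(\mathcal{H})$, every monomorphism $\phi : V(\mathcal{H} \setminus \{e, e'\}) \to V(\mathcal{H})$ is the identity; (v) $e \cap r \neq \emptyset$ and $e \cap g \neq \emptyset$ for every edge $e \in E(\mathcal{H})$, where $r$ and $g$ are the two edges of $\mathcal{H}$ incident with $z$; (vi) $|V(\mathcal{H}) \setminus (r \cup g)| < k-1$. Then the strong game $\mathcal{R}^{(k)}(\mathcal{H}, \aleph_0)$ is a draw.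
   Context: The strong game $\mathcal{R}^{(k)}(\mathcal{H}, \aleph_0)$: FP (first player) and SP (second player) alternately claim unclaimed edges of the countably infinite complete $k$-uniform hypergraph $K^k_{\mathbb{N}}$, one per move, FP first; the first player whose claimed edges contain a copy of $\mathcal{H}$ (a subhypergraph isomorphic to $\mathcal{H}$) wins; if neither player has a strategy ensuring his win in finitely many moves, the game is a draw. $d_{\mathcal H}(x)$ is the number of edges of $\mathcal H$ containing $x$, and $\delta$ is the minimum degree. $\mathcal{H}\setminus\{z\}$ for a vertex $z$ is the hypergraph obtained by deleting $z$ and all edges containing it. For a set $S$ of edges, $\mathcal{H}\setminus S$ is the hypergraph with edge set $E(\mathcal H)\setminus S$, and $V(\mathcal{H}\setminus S)$ denotes the union of its edges. A monomorphism $\phi: V(\mathcal{F}')\to V(\mathcal{F})$ (for $\mathcal F'\subseteq \mathcal F$) is an injective map such that $\phi(x)=\{\phi(a): a\in x\}$ is an edge of $\mathcal F$ for every edge $x$ of $\mathcal F'$; ''$\phi$ is the identity'' means $\phi(a)=a$ for all $a$ in its domain. A $k$-graph $\mathcal{F}$ has a fast winning strategy if, in the game where two players alternately claim unclaimed edges of $K^k_{\mathbb N}$, a player can ensure that his claimed edges contain a copy of $\mathcal{F}$ after $|E(\mathcal{F})|$ of his moves (disregarding whether the opponent builds a copy first). *)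

(* Defs.v *)
From HB Require Import structures.
From mathcomp Require Import all_boot.
From mathcomp Require Import finmap.
Set Implicit Arguments. Unset Strict Implicit. Unset Printing Implicit Defensive.
Local Open Scope fset_scope.

(** Board: the complete k-uniform hypergraph on vertex set nat.
    A board edge is a finite set of naturals of size k. *)
Definition bedge := {fset nat}.

Definition is_kedge (k : nat) (x : bedge) : bool := #|` x| == k.

Definition legal_move (k : nat) (h : seq bedge) (x : bedge) : bool :=
  is_kedge k x && (x \notin h).

Definition legal_hist (k : nat) (h : seq bedge) : Prop :=
  forall i, i < size h -> legal_move k (take i h) (nth fset0 h i).

(** A (infinite) play: m i is the edge claimed at move i (moves 0,2,4,... by FP,
    moves 1,3,5,... by SP). *)
Definition legal_play (k : nat) (m : nat -> bedge) : Prop :=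
  forall i, legal_move k (mkseq m i) (m i).

(** Strategies map finite histories to a move. Player p : bool,
    p = false is FP (moves at even times), p = true is SP (odd times). *)
Definition strategy := seq bedge -> bedge.

Definition strategy_legal (k : nat) (p : bool) (s : strategy) : Prop :=
  forall h, legal_hist k h -> odd (size h) = p -> legal_move k h (s h).

Definition consistent (p : bool) (s : strategy) (m : nat -> bedge) : Prop :=
  forall i, odd i = p -> m i = s (mkseq m i).

Definition claimed (p : bool) (m : nat -> bedge) (n : nat) : bedge -> Prop :=
  fun x => exists i, i < n /\ odd i = p /\ m i = x.

Definition hsupport (V : finType) (E : {set {set V}}) : pred V :=
  [pred x | [exists e in E, x \in e]].

Definition deg (V : finType) (E : {set {set V}}) (u : V) : nat :=
  #|[set e in E | u \in e]|.

Definition del_vertex (V : finType) (E : {set {set V}}) (z : V) : {set {set V}} :=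
  [set e in E | z \notin e].

Definition hasCopy (V : finType) (E : {set {set V}}) (C : bedge -> Prop) : Prop :=
  exists f : V -> nat, {in hsupport E &, injective f} /\
    forall e, e \in E -> C [fset f x | x in enum e].

(** Player p wins the strong game on play m: at some finite time p has a copy
    while the opponent has none (equivalently, p completed a copy first). *)
Definition wins (V : finType) (E : {set {set V}}) (p : bool) (m : nat -> bedge) : Prop :=
  exists n, hasCopy E (claimed p m n) /\ ~ hasCopy E (claimed (~~ p) m n).

Definition winning_strategy (k : nat) (V : finType) (E : {set {set V}})
    (p : bool) (s : strategy) : Prop :=
  strategy_legal k p s /\
  forall m, legal_play k m -> consistent p s m -> wins E p m.

Definition strong_game_draw (k : nat) (V : finType) (E : {set {set V}}) : Prop :=
  ~ (exists s, winning_strategy k E false s) /\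
  ~ (exists s, winning_strategy k E true s).

(** Fast winning strategy: the player moving first can ensure a copy of F
    among his edges after |E(F)| of his own moves. *)
Definition fast_winning (k : nat) (V : finType) (E : {set {set V}}) : Prop :=
  exists s, strategy_legal k false s /\
    forall m, legal_play k m -> consistent false s m ->
      hasCopy E (claimed false m (2 * #|E|)).

Definition hyp_monomorphism (V : finType) (E' E : {set {set V}}) (phi : V -> V) : Prop :=
  {in hsupport E' &, injective phi} /\ forall x, x \in E' -> phi @: x \in E.

(* Main.v *)
Require Import Defs.
From mathcomp Require Import all_boot.
From mathcomp Require Import finmap zify.
From Stdlib Require Import Classical ClassicalEpsilon.
Set Implicit Arguments. Unset Strict Implicit. Unset Printing Implicit Defensive.
Local Open Scope fset_scope.

(** Against any opponent strategy, and whoever moves first, the drawing player builds a copy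
    of H \ {z} (his core) by the fast strategy, vertex-disjoint from the opponent's first
    edge e1. From then on he can threaten for ever: claim r with z replaced by a fresh
    vertex, so that the opponent must claim the corresponding g. The forced edges have a
    vertex of degree 1, so they create a threat of the opponent only if the opponent has a
    core whose links of z are badly placed, and the roles of r and g can be chosen so as to
    avoid this: a badly placed core misses e1 by (v), so that the opponent's first |E| - 1
    edges contain at most one such core by (iv). If instead these first |E| - 1 edges are a
    copy of H minus an edge, the drawing player blocks it. By (iv) and the degree conditions,
    each further threat of the opponent then comes from r and g at a new copy of z, and it is
    blocked as well; as soon as the opponent makes no threat, (vi) gives a choice of roles by
    counting vertices outside e1. *)

(** * Embeddings of hypergraphs into finite sets of board edges *)

Section Embeddings.
Variable V : finType.
Implicit Types (f : V -> nat) (e : {set V}) (E F : {set {set V}}).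

Definition img f e : bedge := [fset f x | x in enum e].

(** Injectivity is asked on the support only, so an embedding of [Ez] leaves the value at [z]
    free. *)
Definition embeds f F (S : {fset bedge}) : Prop :=
  {in hsupport F &, injective f} /\ forall e, e \in F -> img f e \in S.

Lemma imgP f e v : reflect (exists2 x, x \in e & v = f x) (v \in img f e).
Proof.
by apply: (iffP (imfsetP _ _ _ _)) => -[x xe ->]; exists x; rewrite // mem_enum in xe *.
Qed.

Lemma mem_img f e x : x \in e -> f x \in img f e.
Proof. by move=> xe; apply/imgP; exists x. Qed.

Lemma card_img f e : {in e &, injective f} -> #|` img f e| = #|e|.
Proof.
move=> injf; rewrite card_in_imfset /=; first by rewrite undup_id ?enum_uniq // -cardE.
by move=> x y; rewrite !mem_enum; apply: injf.
Qed.

Lemma eq_img f g e : {in e, f =1 g} -> img f e = img g e.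
Proof.
move=> fg; apply/fsetP => v; apply/imgP/imgP => -[x xe ->]; exists x => //.
  exact: fg.
by rewrite fg.
Qed.

Lemma img1U f z e : z \in e -> img f e = f z |` img f (e :\ z).
Proof.
move=> ze; apply/fsetP => v; rewrite in_fset1U.
apply/imgP/orP => [[x xe ->]|[/eqP->|/imgP[x]]]; last 1 first.
- by rewrite !inE => /andP[_ xe] ->; exists x.
- case: (eqVneq x z) => [->|xz]; first by left.
  by right; apply: mem_img; rewrite !inE xz.
- by exists z.
Qed.

Lemma hsupportP F u : reflect (exists2 e, e \in F & u \in e) (u \in hsupport F).
Proof. by apply: (iffP existsP) => [[e /andP[]]|[e eF ue]]; exists e => //; apply/andP. Qed.

Lemma mem_hsupport F e u : e \in F -> u \in e -> u \in hsupport F.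
Proof. by move=> eF ue; apply/hsupportP; exists e. Qed.

Lemma deg_gt0 F u : (0 < deg F u) = (u \in hsupport F).
Proof.
rewrite card_gt0; apply/set0Pn/hsupportP => -[e].
  by rewrite inE => /andP[]; exists e.
by move=> eF ue; exists e; rewrite inE eF.
Qed.

Lemma img_inj F f : {in hsupport F &, injective f} -> {in F &, injective (img f)}.
Proof.
move=> injf e e' eF e'F eq_img; apply/setP => u; apply/idP/idP => ue.
  have /imgP[w we' /injf->] // : f u \in img f e' by rewrite -eq_img mem_img.
    exact: mem_hsupport eF ue.
  exact: mem_hsupport e'F we'.
have /imgP[w we' /injf->] // : f u \in img f e by rewrite eq_img mem_img.
  exact: mem_hsupport e'F ue.
exact: mem_hsupport eF we'.
Qed.

Lemma mem_img_inj F f e u : {in hsupport F &, injective f} -> e \in F ->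
  u \in hsupport F -> (f u \in img f e) = (u \in e).
Proof.
move=> injf eF uF; apply/imgP/idP => [[w we /injf->] //|ue]; last by exists u.
exact: mem_hsupport eF we.
Qed.

Lemma embeds_card f F S : embeds f F S -> #|F| <= #|` S|.
Proof.
case=> injf FS; rewrite cardE -(size_map (img f)); apply: uniq_leq_size.
  rewrite map_inj_in_uniq ?enum_uniq // => x y; rewrite !mem_enum.
  exact: img_inj.
by move=> x /mapP[e]; rewrite mem_enum => eF ->; apply: FS.
Qed.

Lemma embeds_onto f F S : embeds f F S -> #|` S| <= #|F| ->
  forall x, x \in S -> exists2 e, e \in F & x = img f e.
Proof.
case=> injf FS leSF x xS.
have uF : uniq (map (img f) (enum F)).
  by rewrite map_inj_in_uniq ?enum_uniq // => y1 y2; rewrite !mem_enum; apply: img_inj.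
have sFS : {subset map (img f) (enum F) <= S}.
  by move=> y /mapP[e]; rewrite mem_enum => eF ->; apply: FS.
have [|_ eqS] := uniq_min_size uF sFS; first by rewrite size_map -cardE.
move: xS; rewrite -eqS => /mapP[e]; rewrite mem_enum => eF ->; by exists e.
Qed.

(** The source of all contradictions with (ii): few host edges through [f u] force a small degree of
    [u], since distinct edges have distinct images. *)
Lemma deg_le_size f F (L : seq bedge) u : {in hsupport F &, injective f} ->
  (forall e, e \in F -> u \in e -> img f e \in L) -> deg F u <= size L.
Proof.
move=> injf FL; rewrite /deg cardE -(size_map (img f)); apply: uniq_leq_size.
  rewrite map_inj_in_uniq ?enum_uniq // => x y; rewrite !mem_enum !inE.
  by move=> /andP[xF _] /andP[yF _]; apply: (img_inj injf).
by move=> x /mapP[e]; rewrite mem_enum inE => /andP[eF ue] ->; apply: FL.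
Qed.

Lemma embedsS f F S S' : {subset S <= S'} -> embeds f F S -> embeds f F S'.
Proof. by move=> sS [injf FS]; split=> // e eF; apply/sS/FS. Qed.

Lemma embeds_sub f F F' S : F' \subset F -> embeds f F S -> embeds f F' S.
Proof.
move=> /subsetP sF [injf FS]; split=> [u v /hsupportP[e eF ue] /hsupportP[e' eF' ve']|e eF].
  by apply: injf; [apply: mem_hsupport ue | apply: mem_hsupport ve']; apply: sF.
exact/FS/sF.
Qed.

End Embeddings.

(** * Room on the infinite board *)

Lemma fset_bound (S : {fset bedge}) :
  exists N, forall x v, x \in S -> v \in x -> v < N.
Proof.
exists (\max_(x <- S) \max_(v <- x) v).+1 => x v xS vx; rewrite ltnS.
apply: leq_trans (leq_bigmax_seq (F := fun x : bedge => \max_(v <- x) v) _ xS isT).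
exact: (leq_bigmax_seq (F := id) _ vx isT).
Qed.

Lemma fresh_edge k (S : {fset bedge}) : 0 < k -> exists2 x, is_kedge k x & x \notin S.
Proof.
move=> k0; have [N SN] := fset_bound S.
pose x : bedge := [fset (i + N)%N | i in iota 0 k].
have xN : N \in x by apply/imfsetP; exists 0; rewrite //= mem_iota.
exists x; last by apply/negP => xS; have := SN _ _ xS xN; rewrite ltnn.
apply/eqP; rewrite card_imfset /=; last by move=> i j /addIn.
by rewrite undup_id ?iota_uniq // size_iota.
Qed.

(** * Plays, the edges of each side, and draws from an invariant *)

Section Plays.
Variable next : seq bedge -> bedge.

Definition hist n := iter n (fun l => rcons l (next l)) [::].
Definition play i := next (hist i).

Lemma mkseq_play n : mkseq play n = hist n.
Proof. by elim: n => // n IH; rewrite mkseqS IH. Qed.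

Lemma size_hist n : size (hist n) = n.
Proof. by rewrite -mkseq_play size_mkseq. Qed.

Lemma legal_hist_rcons k l x :
  legal_hist k l -> legal_move k l x -> legal_hist k (rcons l x).
Proof.
move=> leg lx i; rewrite size_rcons ltnS leq_eqVlt => /orP[/eqP->|il].
  by rewrite nth_rcons ltnn eqxx -cats1 take_size_cat.
by rewrite nth_rcons il -cats1 takel_cat ?(ltnW il) //; apply: leg.
Qed.

Lemma legal_play_hist k :
  (forall n, legal_hist k (hist n) -> legal_move k (hist n) (next (hist n))) ->
  legal_play k play /\ forall n, legal_hist k (hist n).
Proof.
move=> leg; have legh n : legal_hist k (hist n).
  by elim: n => // n IH; apply: legal_hist_rcons (IH) (leg n IH).
by split=> // i; rewrite mkseq_play; apply: leg.
Qed.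

End Plays.

Definition side (p : bool) (l : seq bedge) : {fset bedge} :=
  [fset nth fset0 l i | i in [seq i <- iota 0 (size l) | odd i == p]].

Lemma sideP p l x :
  reflect (exists i, [/\ i < size l, odd i = p & nth fset0 l i = x]) (x \in side p l).
Proof.
apply: (iffP (imfsetP _ _ _ _)) => /= [[i]|[i [il ip <-]]].
  by rewrite mem_filter mem_iota => /andP[/eqP ip il] ->; exists i.
by exists i; rewrite // mem_filter mem_iota ip eqxx.
Qed.

Lemma mem_side p l x : (x \in l) = (x \in side p l) || (x \in side (~~ p) l).
Proof.
apply/idP/orP => [xl|]; last first.
  by case=> /sideP[i [il _ <-]]; apply: mem_nth.
have il : index x l < size l by rewrite index_mem.
case: (boolP (odd (index x l) == p)) => [/eqP ip|ip]; [left|right];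
  apply/sideP; exists (index x l); rewrite nth_index //; split=> //.
by move: ip; case: odd; case: (p).
Qed.

Lemma side_rcons p l x :
  side p (rcons l x) = if odd (size l) == p then x |` side p l else side p l.
Proof.
apply/fsetP => y; apply/sideP/idP => [[i]|].
  rewrite size_rcons ltnS leq_eqVlt nth_rcons => -[].
  case: ltngtP => //= [il _ ip <-|-> _ -> <-]; last by rewrite !eqxx fset1U1.
  have yin : nth fset0 l i \in side p l by apply/sideP; exists i.
  by case: ifP; rewrite // in_fset1U yin orbT.
have old : y \in side p l -> exists i, [/\ i < size (rcons l x), odd i = p &
    nth fset0 (rcons l x) i = y].
  case/sideP => i [il ip <-]; exists i; rewrite size_rcons nth_rcons il.
  by rewrite ltnS (ltnW il).
case: eqP => // ip; rewrite in_fset1U => /orP[/eqP->|//].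
by exists (size l); rewrite size_rcons nth_rcons ltnn eqxx.
Qed.

Lemma claimed_side p m n x : claimed p m n x <-> x \in side p (mkseq m n).
Proof.
split=> [[i [il [ip <-]]]|/sideP[i []]].
  by apply/sideP; exists i; rewrite size_mkseq nth_mkseq.
by rewrite size_mkseq => il ip; rewrite nth_mkseq // => <-; exists i.
Qed.

Lemma hasCopy_side (V : finType) (E : {set {set V}}) p m n :
  hasCopy E (claimed p m n) <-> exists f, embeds f E (side p (mkseq m n)).
Proof. by split=> -[f [injf fE]]; exists f; split=> // e /fE/claimed_side. Qed.

(* [A] and [B] are the edge sets of a player following the strategy [s] and of the
   player answering so as to keep [Inv]. *)
Lemma draw_of_invariant k (V : finType) (E : {set {set V}})
    (Inv : {fset bedge} -> {fset bedge} -> Prop) :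
  0 < k -> E != set0 -> (forall B, Inv fset0 B) ->
  (forall A B a, Inv A B -> [disjoint A & B] -> is_kedge k a -> a \notin A -> a \notin B ->
    exists b, [/\ is_kedge k b, b \notin a |` A, b \notin B & Inv (a |` A) (b |` B)]) ->
  (forall A B a, Inv A B -> [disjoint A & B] -> a \notin A -> a \notin B ->
    (exists f, embeds f E (a |` A)) -> exists f, embeds f E B) ->
  strong_game_draw k E.
Proof.
move=> k0 /set0Pn[e0 e0E] Inv0 Inv_step Inv_safe.
suff nowin p s : ~ winning_strategy k E p s by split=> -[s] /nowin.
move=> [legs wins_s].
pose good A B b := [/\ is_kedge k b, b \notin A, b \notin B & Inv A (b |` B)].
(* [resp] picks an answer that keeps the invariant; the play [play next] then sets [s] against
   it. *)
pose resp A B := epsilon (inhabits fset0) (good A B).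
pose next l := if odd (size l) == p then s l else resp (side p l) (side (~~ p) l).
have notin l x : (x \notin l) = (x \notin side p l) && (x \notin side (~~ p) l).
  by rewrite (mem_side p) negb_or.
(* [Inv] is asserted only when [s] is to move. After a move of [s], what is kept is that a good
   answer exists and that any copy of [s] is matched by one of the other side. *)
pose Q l := [/\ [disjoint side p l & side (~~ p) l],
  odd (size l) = p -> Inv (side p l) (side (~~ p) l) &
  odd (size l) <> p -> (exists b, good (side p l) (side (~~ p) l) b) /\
    ((exists f, embeds f E (side p l)) -> exists f, embeds f E (side (~~ p) l))].
have side0 p' : side p' [::] = fset0 by apply/fsetP => x; apply/sideP => -[i []].
have next_legal l : legal_hist k l -> Q l -> legal_move k l (next l).
  move=> ll [_ _ QD]; rewrite /next; case: eqP => [|/QD[exb _]]; first exact: legs.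
  have [kb bA bB _] := epsilon_spec (inhabits fset0) _ exb.
  by rewrite /legal_move kb notin bA bB.
have Q0 : Q [::].
  (* If [s] plays second, the other side opens with an arbitrary edge; [Inv0] allows every [B] for
     this reason. *)
  rewrite /Q !side0; split=> [||_]; [exact: fdisjoint0X|by []|split].
    have [b kb _] := fresh_edge fset0 k0.
    by exists b; split=> //; rewrite ?inE //; apply: Inv0.
  by case=> f [_ /(_ e0 e0E)]; rewrite inE.
have Q_step l : legal_hist k l -> Q l -> Q (rcons l (next l)).
  move=> ll Ql; have := next_legal l ll Ql; rewrite /legal_move notin.
  case: Ql => dis QO QD /andP[kx /andP[xA xB]].
  rewrite /Q size_rcons !side_rcons /= /next in kx xA xB *.
  case: eqP => [ip|/eqP ip] in kx xA xB *.
    have -> : (odd (size l) == ~~ p) = false by rewrite ip; case: (p).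
    split=> [|/eqP|_]; first by rewrite fdisjointU1X xB.
      by rewrite ip; case: (p).
    split; last exact: Inv_safe (QO ip) dis xA xB.
    have [b [kb bA bB Ib]] := Inv_step _ _ _ (QO ip) dis kx xA xB.
    by exists b.
  have -> : (odd (size l) == ~~ p) = true by move: ip; case: odd; case: (p).
  have [exb _] := QD (elimN eqP ip).
  have [_ _ _ Ib] := epsilon_spec (inhabits fset0) _ exb.
  split=> // [|/eqP nip]; first by rewrite fdisjoint_sym fdisjointU1X xA fdisjoint_sym.
  by move: nip ip; case: odd; case: (p).
have legQ n : legal_hist k (hist next n) /\ Q (hist next n).
  elim: n => [|n [ll Ql]]; first by split=> // i.
  by split; [apply: legal_hist_rcons => //; apply: next_legal|apply: Q_step].
have [legp _] : legal_play k (play next) /\ forall n, legal_hist k (hist next n).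
  by apply: legal_play_hist => n _; apply: next_legal; case: (legQ n).
have [|n [/hasCopy_side cA ncB]] := wins_s _ legp.
  by move=> i ip; rewrite mkseq_play /play {1}/next size_hist ip eqxx.
apply: ncB; apply/hasCopy_side; move: cA; rewrite mkseq_play.
have [_ [dis QO QD]] := legQ n; case: (eqVneq (odd (size (hist next n))) p) => [ip|/eqP ip].
  (* Safety speaks of [A] with one more edge, so a copy in [A] is padded with a free edge [a]. *)
  case=> f emf; have [a _] := fresh_edge (side p (hist next n) `|` side (~~ p) (hist next n)) k0.
  rewrite in_fsetU negb_or => /andP[aA aB].
  apply: (Inv_safe _ _ a (QO ip)) => //; exists f; apply: embedsS emf => x xA.
  by rewrite in_fset1U xA orbT.
by have [] := QD ip.
Qed.

(** Turns the statement on infinite plays into one on finite histories, which can be simulated: a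
    history is continued by [s] on one side and by arbitrary free edges on the other. *)
Lemma fast_winning_finite k (V : finType) (E : {set {set V}}) : 0 < k -> fast_winning k E ->
  exists s, strategy_legal k false s /\ forall l, legal_hist k l ->
    (forall i, i < size l -> ~~ odd i -> nth fset0 l i = s (take i l)) ->
    (size l).+1 = 2 * #|E| -> exists f, embeds f E (side false l).
Proof.
move=> k0 [s [legs win]]; exists s; split=> // l ll con sl.
pose free l' := epsilon (inhabits fset0) (legal_move k l').
pose next l' := if size l' < size l then nth fset0 l (size l') else
  if odd (size l') then free l' else s l'.
have free_legal l' : legal_move k l' (free l').
  suff /(epsilon_spec (inhabits fset0)) : exists x, legal_move k l' x by [].
  have [x kx] := fresh_edge [fset y in l'] k0.
  by rewrite inE => xl; exists x; rewrite /legal_move kx.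
have hist_take n : n <= size l -> hist next n = take n l.
  elim: n => [|n IH] nl; first by rewrite take0.
  rewrite [hist _ _]/= -/(hist next n) IH ?(ltnW nl) // /next size_takel ?(ltnW nl) // nl.
  by rewrite (take_nth fset0 nl).
have [legp _] : legal_play k (play next) /\ forall n, legal_hist k (hist next n).
  apply: legal_play_hist => n ln; rewrite /next size_hist.
  case: (ltnP n (size l)) => nl; first by rewrite hist_take ?(ltnW nl) //; apply: ll.
  by case: (boolP (odd n)) => // /negPf on; apply: legs => //; rewrite size_hist.
have conp : consistent false s (play next).
  move=> i oi; rewrite mkseq_play /play {1}/next size_hist oi.
  case: (ltnP i (size l)) => il //.
  by rewrite con ?oi // hist_take // ltnW.
have /hasCopy_side[f] := win _ legp conp.
rewrite -sl mkseq_play [hist _ _]/= -/(hist next (size l)) hist_take // take_size.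
(* The last of the [2 * #|E|] moves has odd index, hence adds nothing to the edges of the player
   using [s]. *)
rewrite side_rcons; have -> : (odd (size l) == false) = false.
  by have := congr1 odd sl; rewrite oddM /= => /negbFE->.
by exists f.
Qed.

(** * First consequences of the hypotheses, and rigidity of copies *)

Section Draw.
Variables (k : nat) (V : finType) (E : {set {set V}}) (z : V).
Hypothesis k_ge2 : 2 <= k.
Hypothesis E_unif : forall e, e \in E -> #|e| = k.
Hypothesis deg_z : deg E z = 2.
Hypothesis deg_del : forall u, u != z -> 3 <= deg (del_vertex E z) u.
Hypothesis deg_E : forall u, u != z -> 4 <= deg E u.
Hypothesis fast : fast_winning k (del_vertex E z).
Hypothesis mono_id : forall e e', e \in E -> e' \in E -> e != e' ->
  forall phi : V -> V, hyp_monomorphism (E :\: [set e; e']) E phi ->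
    {in hsupport (E :\: [set e; e']), forall a, phi a = a}.
Hypothesis meet_rg : forall r g, r \in E -> g \in E -> r != g -> z \in r -> z \in g ->
  forall e, e \in E -> e :&: r != set0 /\ e :&: g != set0.
Hypothesis small_rg : forall r g, r \in E -> g \in E -> r != g -> z \in r -> z \in g ->
  #|~: (r :|: g)| < k.-1.

Local Notation Ez := (del_vertex E z).

Implicit Types (c d e p q : {set V}) (F : {set {set V}}) (f h : V -> nat) (u w : V).
Implicit Types (a : bedge) (A B S : {fset bedge}).

(** By (i) the only such pairs are [(r, g)] and [(g, r)]; keeping the order allows the two roles to
    be exchanged. *)
Definition twin (c d : {set V}) : Prop :=
  [/\ c \in E, d \in E, c != d, z \in c & z \in d].

Lemma twinC c d : twin c d -> twin d c.
Proof. by case=> cE dE cd zc zd; split; rewrite // eq_sym. Qed.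

Lemma exists_twin : exists r g, twin r g.
Proof.
have /cards2P[r [g [rg eqS]]] : #|[set e in E | z \in e]| == 2 by apply/eqP.
have: r \in [set e in E | z \in e] by rewrite eqS !inE eqxx.
have: g \in [set e in E | z \in e] by rewrite eqS !inE eqxx orbT.
by rewrite !inE => /andP[gE zg] /andP[rE zr]; exists r, g.
Qed.

Lemma twinP c d x : twin c d -> x \in E -> z \in x -> x = c \/ x = d.
Proof.
case=> cE dE cd zc zd xE zx.
have /eqP/cards2P[r [g [rg eqS]]] := deg_z.
have inS y : y \in E -> z \in y -> y \in [set r; g] by rewrite -eqS inE => -> ->.
move: (inS c cE zc) (inS d dE zd) (inS x xE zx) cd; rewrite !inE.
by do 3!case/orP=> /eqP->; rewrite ?eqxx //; tauto.
Qed.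

Lemma in_Ez x : (x \in Ez) = (x \in E) && (z \notin x).
Proof. by rewrite inE. Qed.

Lemma EzD c d : twin c d -> Ez = E :\: [set c; d].
Proof.
move=> tw; apply/setP => x; rewrite in_Ez !inE andbC.
case xE : (x \in E); rewrite ?andbF // !andbT; congr (~~ _).
apply/idP/orP => [zx|]; first by case: (twinP tw xE zx) => ->; rewrite eqxx; auto.
by case: tw => ? ? ? ? ? [] /eqP->.
Qed.

Lemma subEz : Ez \subset E.
Proof. by apply/subsetP => x; rewrite in_Ez => /andP[]. Qed.

Lemma card_Ez : #|Ez|.+2 = #|E|.
Proof.
have [r [g tw]] := exists_twin; rewrite (EzD tw) cardsD.
case: tw => rE gE rg _ _.
have sub : [set r; g] \subset E by apply/subsetP => x; rewrite !inE => /orP[] /eqP->.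
by have := subset_leq_card sub; rewrite (setIidPr sub) cards2 rg; case: #|E| => [|[|n]] // _; rewrite subn2.
Qed.

Lemma hsupp_E u : u \in hsupport E.
Proof.
rewrite -deg_gt0; case: (eqVneq u z) => [->|uz]; first by rewrite deg_z.
exact: leq_trans (deg_E uz).
Qed.

Lemma hsupp_Ez u : (u \in hsupport Ez) = (u != z).
Proof.
case: (eqVneq u z) => [->|uz] /=.
  by apply/negbTE/negP => /hsupportP[e]; rewrite in_Ez => /andP[_ /negPf->].
by rewrite -deg_gt0; apply: leq_trans (deg_del uz).
Qed.

Lemma hsupp_D2 e e' u : u != z -> u \in hsupport (E :\: [set e; e']).
Proof.
move=> uz; rewrite -deg_gt0 /deg.
have -> : [set x in E :\: [set e; e'] | u \in x] = [set x in E | u \in x] :\: [set e; e'].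
  by apply/setP => x; rewrite !inE andbA.
rewrite cardsD subn_gt0; apply: leq_trans (ltnW (deg_E uz)); rewrite ltnS.
by apply: leq_trans (subset_leq_card (subsetIr _ _)) _; rewrite cards2; case: eqP.
Qed.

Lemma hsupp_D2z e e' : e \in E -> e' \in E -> e != e' -> ~ twin e e' ->
  z \in hsupport (E :\: [set e; e']).
Proof.
move=> eE e'E ee' ntw; have [r [g tw]] := exists_twin.
have [rE gE rg zr zg] := tw; apply/hsupportP.
case: (boolP (r \in [set e; e'])) => [rin|]; last first.
  by move=> rn; exists r; rewrite // in_setD rn.
case: (boolP (g \in [set e; e'])) => [gin|]; last first.
  by move=> gn; exists g; rewrite // in_setD gn.
case: ntw; case/set2P: rin gin => re /set2P[] ge; move: rg; rewrite re ge ?eqxx // => _.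
  by rewrite -re -ge.
by apply: twinC; rewrite -re -ge.
Qed.

Lemma Ez_neq0 : exists x, x \in Ez.
Proof.
have [r [g [rE _ _ zr _]]] := exists_twin.
have : 0 < #|r :\ z| by have := cardsD1 z r; rewrite zr E_unif //; lia.
move/card_gt0P => [u]; rewrite !inE -hsupp_Ez => /andP[/hsupportP[x xE _] _].
by exists x.
Qed.

(** Allows (iv) to be used when only [e] is missing: a second edge is given up, chosen so that [z]
    still lies on a remaining edge. *)
Lemma not_twin_partner e : e \in E -> exists e', [/\ e' \in E, e != e' & ~ twin e e'].
Proof.
move=> eE; have [x xEz] := Ez_neq0; have [r [g [rE _ _ zr _]]] := exists_twin.
move: xEz; rewrite in_Ez => /andP[xE zx].
case: (boolP (z \in e)) => ze.
  exists x; split=> //; last by case=> _ _ _ _ /(negP zx).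
  by apply: contraNneq zx => <-.
by exists r; split=> //; [apply: contraNneq ze => ->|case=> _ _ _ /(negP ze)].
Qed.

(* (iv), transported along embeddings of subhypergraphs of H into a common host. *)
Lemma rigid e e' (F : {set {set V}}) (f f' : V -> nat) :
  e \in E -> e' \in E -> e != e' -> F \subset E -> {in hsupport F &, injective f} ->
  {in hsupport (E :\: [set e; e']) &, injective f'} ->
  (forall x, x \in E :\: [set e; e'] -> exists2 y, y \in F & img f' x = img f y) ->
  {in hsupport (E :\: [set e; e']), f' =1 f}.
Proof.
move=> eE e'E ee' sFE injf injf' im.
set D := E :\: [set e; e'] in injf' im *.
(* The map fed to (iv) is [f'] followed by the inverse of [f]; the default [u] can only occur off
   the support of [D]. *)
pose phi u := odflt u [pick w | (w \in hsupport F) && (f w == f' u)].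
have phiP u : u \in hsupport D -> phi u \in hsupport F /\ f (phi u) = f' u.
  move=> /hsupportP[x xD ux]; have [y yF eq_im] := im x xD.
  have /imgP[w wy f'u] : f' u \in img f y by rewrite -eq_im mem_img.
  rewrite /phi; case: pickP => [w' /andP[? /eqP] //|/(_ w)].
  by rewrite (mem_hsupport yF wy) f'u eqxx.
have mono : hyp_monomorphism D E phi.
  split=> [u v uD vD eq_phi|x xD].
    by apply: injf' => //; rewrite -(phiP u uD).2 -(phiP v vD).2 eq_phi.
  have [y yF eq_im] := im x xD; suff -> : phi @: x = y by apply: (subsetP sFE).
  have inx u : u \in x -> u \in hsupport D by move=> ux; apply: mem_hsupport xD ux.
  apply/setP => w; apply/imsetP/idP => [[u ux ->]|wy].
    have [phiF fphi] := phiP u (inx u ux).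
    by rewrite -(mem_img_inj injf yF phiF) fphi -eq_im mem_img.
  have /imgP[u ux fw] : f w \in img f' x by rewrite eq_im mem_img.
  exists u => //; have [phiF fphi] := phiP u (inx u ux).
  by apply: injf => //; [apply: mem_hsupport yF wy | rewrite fphi].
move=> u uD; rewrite -(phiP u uD).2; congr f; exact: mono_id mono u uD.
Qed.

Lemma twin_partner c : c \in E -> z \in c -> exists d, twin c d.
Proof.
move=> cE zc; have [r [g tw]] := exists_twin.
by case: (twinP tw cE zc) => ->; [exists g | exists r; apply: twinC].
Qed.

Lemma small_deg u : deg E u <= 3 -> u = z.
Proof. by move=> du; apply/eqP/contraT => /deg_E; rewrite leqNgt ltnS du. Qed.

Lemma inj_E f S : embeds f E S -> injective f.
Proof. by case=> injf _ u v; apply: injf; apply: hsupp_E. Qed.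

Lemma inj_Ez f S : embeds f Ez S -> {in predC1 z &, injective f}.
Proof. by case=> injf _ u v uz vz; apply: injf; rewrite hsupp_Ez. Qed.

(** Removing two edges isolates no vertex other than [z], and isolates [z] only if they are the two
    edges at [z]; hence the two conclusions. *)
Lemma rigid_E e e' (F : {set {set V}}) (f f' : V -> nat) :
  e \in E -> e' \in E -> e != e' -> F \subset E -> {in hsupport F &, injective f} ->
  {in hsupport (E :\: [set e; e']) &, injective f'} ->
  (forall x, x \in E -> x != e -> x != e' -> exists2 y, y \in F & img f' x = img f y) ->
  (forall u, u != z -> f' u = f u) /\ (~ twin e e' -> f' =1 f).
Proof.
move=> eE e'E ee' sF injf injf' im.
have eqD : {in hsupport (E :\: [set e; e']), f' =1 f}.
  apply: (rigid eE e'E ee' sF injf injf') => x.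
  by rewrite !inE negb_or => /andP[/andP[xe xe'] xE]; apply: im.
have eqz u : u != z -> f' u = f u by move=> uz; apply/eqD/hsupp_D2.
split=> // ntw u; case: (eqVneq u z) => [->|]; last exact: eqz.
by apply: eqD; apply: hsupp_D2z.
Qed.

(** * Pendant edges at new copies of [z], and the perpetual threat *)

(** The image of an edge [c] at [z] when [f] is changed to send [z] to [v]. *)
Local Notation pendant f v c := (v |` img f (c :\ z)).

Lemma pendantE f c : z \in c -> img f c = pendant f (f z) c.
Proof. exact: img1U. Qed.

Lemma fsetU1_inj (v : nat) (X Y : {fset nat}) :
  v \notin X -> v \notin Y -> v |` X = v |` Y -> X = Y.
Proof.
by move=> vX vY eqXY; rewrite -(fsetU1K vX) eqXY fsetU1K.
Qed.

Lemma notin_img f v e : (forall u, u != z -> v != f u) -> v \notin img f (e :\ z).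
Proof.
move=> vf; apply/negP => /imgP[u]; rewrite !inE => /andP[uz _] eqv.
by have := vf u uz; rewrite eqv eqxx.
Qed.

Lemma kedge_pendant f S v c : embeds f Ez S -> (forall u, u != z -> v != f u) ->
  c \in E -> z \in c -> is_kedge k (pendant f v c).
Proof.
move=> emf vf cE zc; rewrite /is_kedge cardfsU1 notin_img // card_img.
  by rewrite -(E_unif cE) (cardsD1 z c) zc.
by move=> u w; rewrite !inE => /andP[uz _] /andP[wz _]; apply: (inj_Ez emf).
Qed.

(** Why a pendant edge is a threat: sending [z] to [v] extends the core once both pendant edges at
    [v] are claimed. *)
Lemma core_extend f v c d (S S' : {fset bedge}) :
  embeds f Ez S -> {subset S <= S'} -> twin c d -> (forall u, u != z -> v != f u) ->
  pendant f v c \in S' -> pendant f v d \in S' -> exists g, embeds g E S'.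
Proof.
move=> emf sS tw vf cS dS; exists (fun u => if u == z then v else f u).
set g := fun u => _.
have gz : g z = v by rewrite /g eqxx.
have gf u : u != z -> g u = f u by rewrite /g => /negPf->.
split=> [u w _ _|e eE].
  case: (eqVneq u z) (eqVneq w z) => [->|uz] [->|wz] //; rewrite ?gz ?gf //.
  - by move=> eqv; have := vf w wz; rewrite eqv eqxx.
  - by move=> eqv; have := vf u uz; rewrite eqv eqxx.
  by apply: (inj_Ez emf).
case: (boolP (z \in e)) => ze.
  have eqim : img g (e :\ z) = img f (e :\ z).
    by apply: eq_img => u; rewrite !inE => /andP[uz _]; apply: gf.
  by rewrite pendantE // gz eqim; case: (twinP tw eE ze) => ->.
have -> : img g e = img f e.
  by apply: eq_img => u ue; apply: gf; apply: contraNneq ze => <-.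
by apply: sS; apply: emf.2; rewrite in_Ez eE.
Qed.

(** The edge [y] may lie in [A], so a complete copy in [A] is excluded too. *)
Definition no_threat (A B : {fset bedge}) : Prop :=
  forall f y, y \notin B -> ~ embeds f E (y |` A).

Lemma no_threatS A (B B' : {fset bedge}) : {subset B <= B'} -> no_threat A B -> no_threat A B'.
Proof. by move=> sB nt f y yB'; apply: nt; apply: contraNN yB' => /sB. Qed.

Lemma embeds_used (F : {set {set V}}) f y (S : {fset bedge}) :
  embeds f F (y |` S) -> (exists2 e, e \in F & img f e = y) \/ embeds f F S.
Proof.
move=> [injf FS]; case: (classic (exists2 e, e \in F & img f e = y)); first by left.
move=> nex; right; split=> // e eF; have := FS e eF; rewrite in_fset1U.
by case/orP => // /eqP eqy; case: nex; exists e.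
Qed.

(* Answering the threat [pendant f v c] with [pendant f v d] creates a threat only
   through a core in [A] that violates [pinned f c d A]. *)
Definition pinned f c d A : Prop := forall h c' d', twin c' d' -> embeds h Ez A ->
  img h (c' :\ z) = img f (d :\ z) -> img h (d' :\ z) = img f (c :\ z).

(** A new threat must use the forced edge [P], the only edge of the opponent through [v]. The vertex
    sent to [v] then has degree at most 2, so it is [z], and the threat consists of a core in [A]
    with [P] and [y]. Being pinned, the core makes [y] the edge [pendant f v c], which is already in
    [B]. *)
Lemma forced_no_threat f c d v A B : twin c d ->
  no_threat A B -> pinned f c d A -> (forall x, x \in A -> v \notin x) ->
  (forall u, u != z -> v != f u) -> pendant f v c \in B ->
  no_threat (pendant f v d |` A) B.
Proof.
move=> tw nt pin vA vf cB h y yB; set P := pendant f v d => emh.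
have emh' : embeds h E (P |` (y |` A)) by rewrite fsetUCA.
case: (embeds_used emh') => [[p pE hp]|]; last exact: nt.
have injh := inj_E emh; have injh' := img_inj emh.1.
have /imgP[u up vu] : v \in img h p by rewrite hp fset1U1.
have through x : x \in E -> u \in x -> img h x \in [:: y; P].
  move=> xE ux; have := emh.2 x xE; rewrite !inE orbA => /orP[] // /vA.
  by rewrite vu mem_img.
have uz : u = z by apply: small_deg; apply: leq_trans (deg_le_size emh.1 through) _.
subst u; have [q tw'] := twin_partner pE up; have [_ qE pq _ zq] := tw'.
have hq : img h q = y.
  have := through q qE zq; rewrite !inE => /orP[/eqP //|/eqP]; rewrite -hp.
  by move=> /(injh' _ _ qE pE) eqp; rewrite eqp eqxx in pq.
have emA : embeds h Ez A.
  split=> [|x xEz]; first exact: (embeds_sub subEz emh).1.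
  move: (xEz); rewrite in_Ez => /andP[xE zx]; have := emh.2 x xE.
  rewrite !inE => /or3P[/eqP hx|/eqP hx|//].
    by rewrite -hq in hx; rewrite (injh' _ _ xE qE hx) zq in zx.
  by rewrite -/P -hp in hx; rewrite (injh' _ _ xE pE hx) up in zx.
have vh e : v \notin img h (e :\ z).
  by apply: notin_img => w wz; rewrite vu (inj_eq injh) eq_sym.
have eqd : img h (p :\ z) = img f (d :\ z).
  by apply: (fsetU1_inj (vh p) (notin_img _ vf)); rewrite {1}vu -pendantE.
have eqc := pin h p q tw' emA eqd.
by move: yB; rewrite -hq pendantE // -vu eqc cB.
Qed.

(** No core can use the forced edge: [v] lies on no other edge of the opponent, while core vertices
    have degree at least 3. *)
Lemma forced_pinned f c d v A : pinned f c d A -> (forall x, x \in A -> v \notin x) ->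
  pinned f c d (pendant f v d |` A).
Proof.
move=> pin vA h c' d' tw emh; apply: pin => //.
case: (embeds_used emh) => // -[x xEz hx].
have /imgP[u ux vu] : v \in img h x by rewrite hx fset1U1.
have uz : u != z by move: xEz; rewrite in_Ez => /andP[_]; apply: contraNneq => <-.
suff : deg Ez u <= 1 by rewrite leqNgt (ltnW (deg_del uz)).
apply: (deg_le_size (L := [:: pendant f v d]) emh.1) => e eEz ue.
by have := emh.2 e eEz; rewrite !inE => /orP[//|/vA]; rewrite vu mem_img.
Qed.

Lemma fresh_vertex f (A B : {fset bedge}) : embeds f Ez B -> exists v,
  [/\ forall x, x \in A -> v \notin x, forall x, x \in B -> v \notin x
    & forall u, u != z -> v != f u].
Proof.
move=> emf; have [N bN] := fset_bound (A `|` B).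
have NA x : x \in A `|` B -> N \notin x.
  by move=> xAB; apply/negP => /(bN _ _ xAB); rewrite ltnn.
exists N; split=> [x xA|x xB|u]; try by apply: NA; rewrite inE ?xA ?xB ?orbT.
rewrite -hsupp_Ez => /hsupportP[e eEz ue]; apply: contraNneq (NA (img f e) _) => [->|].
  exact: mem_img.
by rewrite inE emf.2 ?orbT.
Qed.

(** A position with a standing threat at [v], the opponent to move. The edge [pendant f v d] is
    free, as [v] is on no edge of [A]. *)
Definition forcing (A B : {fset bedge}) : Prop := exists f c d v,
  [/\ twin c d, embeds f Ez B, no_threat A B, pinned f c d A &
      [/\ pendant f v c \in B, pendant f v d \notin B, forall x, x \in A -> v \notin x &
          forall u, u != z -> v != f u]].

Lemma link_inj f c d : {in predC1 z &, injective f} -> z \in c -> z \in d ->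
  img f (c :\ z) = img f (d :\ z) -> c = d.
Proof.
move=> injf zc zd eqi; rewrite -(setD1K zc) -(setD1K zd); congr (_ |: _).
have sub p q : img f (p :\ z) = img f (q :\ z) -> p :\ z \subset q :\ z.
  move=> eqpq; apply/subsetP => u up.
  have /imgP[w wq] : f u \in img f (q :\ z) by rewrite -eqpq mem_img.
  move/injf => -> //; first by move: up; rewrite !inE => /andP[].
  by move: wq; rewrite !inE => /andP[].
by apply/eqP; rewrite eqEsubset !sub.
Qed.

Lemma pendant_neq f v c d S : twin c d -> embeds f Ez S -> (forall u, u != z -> v != f u) ->
  pendant f v c != pendant f v d.
Proof.
move=> [cE dE cd zc zd] emf vf; apply: contraNneq cd => eqp.
by apply/eqP/(link_inj (inj_Ez emf) zc zd)/(fsetU1_inj (notin_img _ vf) (notin_img _ vf)).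
Qed.

Lemma forcing_start f c d A B : twin c d -> embeds f Ez B -> no_threat A B ->
  pinned f c d A -> exists b, [/\ is_kedge k b, b \notin A, b \notin B & forcing A (b |` B)].
Proof.
move=> tw emf nt pin; have [cE dE cd zc zd] := tw.
have [v [vA vB vf]] := fresh_vertex A emf.
have vp e : v \in pendant f v e by rewrite fset1U1.
exists (pendant f v c); split.
- exact: kedge_pendant emf vf cE zc.
- by apply/negP => /vA; rewrite vp.
- by apply/negP => /vB; rewrite vp.
have sB : {subset B <= pendant f v c |` B} by move=> x xB; rewrite in_fset1U xB orbT.
exists f, c, d, v; split=> //; first exact: embedsS emf.
  exact: no_threatS nt.
split=> //; first by rewrite fset1U1.
rewrite in_fset1U negb_or eq_sym (pendant_neq tw emf vf) /=.
by apply/negP => /vB; rewrite vp.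
Qed.

(** If the opponent blocks, the same core and the same roles give a new threat at a fresh vertex;
    otherwise the copy is completed. *)
Lemma forcing_step A B a : forcing A B -> a \notin A -> a \notin B ->
  exists b, [/\ is_kedge k b, b \notin a |` A, b \notin B &
    forcing (a |` A) (b |` B) \/ exists g, embeds g E (b |` B)].
Proof.
move=> [f [c [d [v [tw emf nt pin [cB dB vA vf]]]]]] aA aB.
case: (eqVneq a (pendant f v d)) => [->|ad].
  have [b [kb bA bB fo]] := forcing_start tw emf
    (forced_no_threat tw nt pin vA vf cB) (forced_pinned pin vA).
  by exists b; split=> //; left.
have [cE dE cd zc zd] := tw.
exists (pendant f v d); split=> //.
- exact: kedge_pendant emf vf dE zd.
- rewrite in_fset1U negb_or eq_sym ad /=; apply/negP => /vA; by rewrite fset1U1.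
right; apply: (core_extend emf _ tw vf); rewrite ?fset1U1 // ?in_fset1U ?cB ?orbT //.
by move=> x xB; rewrite in_fset1U xB orbT.
Qed.

(** * Blocked copies of [H] minus an edge, and the threats they still allow *)

Lemma twin_uniq c d d' : twin c d -> twin c d' -> d = d'.
Proof.
move=> tw [_ d'E cd' _ zd']; case: (twinP tw d'E zd') => // eqd.
by rewrite eqd eqxx in cd'.
Qed.

(* Opponent edges that came from threats at a new copy [v] of [z], blocked at once. *)
Definition blocked_pendant h B (x : bedge) : Prop := exists c d v,
  [/\ twin c d, forall u, v != h u, x = pendant h v c & pendant h v d \in B].

(** The opponent owns the copy [h] of [H] except for [img h e]. His other edges are halves of
    blocked threats, which arise only if [e] passes through [z], as [blocked_threat] shows. *)
Definition blocked h e A B : Prop :=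
  [/\ injective h, e \in E, forall x, x \in E -> x != e -> img h x \in A, img h e \in B &
      forall y, y \in A -> (exists x, [/\ x \in E, x != e & y = img h x]) \/
        (z \in e /\ blocked_pendant h B y)].

Lemma img_range h v e : (forall u, v != h u) -> v \notin img h e.
Proof. by move=> vh; apply/negP => /imgP[u _ eqv]; have := vh u; rewrite eqv eqxx. Qed.

Lemma pendant_vertex h v v' c : (forall u, v' != h u) -> v' \in pendant h v c -> v' = v.
Proof. by move=> vh; rewrite in_fset1U (negPf (img_range _ vh)) orbF => /eqP. Qed.

(** Off the copy [h], only the two pendant edges at [v] can contain [v]; if one is in [A], the other
    is in [B]. *)
Lemma blocked_outside h e A B v (x y : bedge) : blocked h e A B -> [disjoint A & B] ->
  (forall u, v != h u) -> x \in A -> y \in A -> v \in x -> v \in y -> x = y.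
Proof.
move=> [injh eE _ _ cls] dis vh xA yA vx vy.
have pen x' : x' \in A -> v \in x' -> exists c d,
    [/\ twin c d, x' = pendant h v c & pendant h v d \in B].
  move=> xA' vx'; case: (cls x' xA') => [[w [_ _ eqx]]|[_ [c [d [v' [tw vh' eqx dB]]]]]].
    by move: vx'; rewrite eqx (negPf (img_range _ vh)).
  have eqv : v = v' by apply: (pendant_vertex vh (c := c)); rewrite -eqx.
  by exists c, d; rewrite eqv.
have [c [d [tw eqx dB]]] := pen x xA vx.
have [c' [d' [[c'E _ _ zc' _] eqy _]]] := pen y yA vy.
case: (twinP tw c'E zc') => eqc; rewrite eqc in eqy; first by rewrite eqx.
by move/fdisjointP/(_ y yA): dis; rewrite eqy dB.
Qed.

(** A copy [g] needing only [y] either uses a blocked pendant edge, and then rigidity identifies [y]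
    with the blocking edge, or lives on edges of [h], and then rigidity gives [g = h], although
    [img h e] is in [B]. *)
Lemma blocked_no_threat h e A B : blocked h e A B -> [disjoint A & B] -> no_threat A B.
Proof.
move=> blk dis g y yB emb; have [injh eE hA heB cls] := blk.
have injg := inj_E emb; have injg' := img_inj emb.1.
have disj x : x \in A -> x \notin B by apply/fdisjointP.
have noteq : ~ g =1 h.
  move=> gh; have := emb.2 e eE; rewrite (@eq_img _ g h e) => [|u _]; last exact: gh.
  rewrite in_fset1U => /orP[/eqP eqy|/disj]; last by rewrite heB.
  by rewrite -eqy heB in yB.
have Z x c v : x \in E -> img g x \in A -> (forall u, v != h u) ->
    img g x = pendant h v c -> z \in x /\ v = g z.
  move=> xE xA vh eqx; have /imgP[u ux vu] : v \in img g x by rewrite eqx fset1U1.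
  suff uz : u = z by rewrite -uz.
  apply/small_deg/(leq_trans (n := 2)) => //.
  apply: (deg_le_size (L := [:: y; img g x]) emb.1) => x' x'E ux'.
  have vx' : v \in img g x' by rewrite vu mem_img.
  have := emb.2 x' x'E; rewrite !inE => /orP[-> //|xA'].
  apply/orP; right; apply/eqP; apply: (blocked_outside blk dis vh) => //.
  by rewrite eqx fset1U1.
case: (classic (exists p, [/\ p \in E, img g p \in A & blocked_pendant h B (img g p)])).
  move=> [p [pE pA [c [d [v [tw vh eqp dB]]]]]].
  have [zp vz] := Z p c v pE pA vh eqp.
  have [q tw'] := twin_partner pE zp; have [_ qE pq _ zq] := tw'.
  have hq : img g q = y.
    have := emb.2 q qE; rewrite in_fset1U => /orP[/eqP //|qA].
    have eqq : img g q = img g p.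
      by apply: (blocked_outside blk dis vh); rewrite // vz mem_img.
    by rewrite (injg' _ _ qE pE eqq) eqxx in pq.
  have [x xE xp xq|eqz _] := rigid_E (F := E) pE qE pq (subxx _) (in2W injh) (in2W injg).
    have zx : z \notin x.
      by apply/negP => zx; case: (twinP tw' xE zx) => eqx; rewrite eqx eqxx in xp xq.
    have xA : img g x \in A.
      have := emb.2 x xE; rewrite in_fset1U => /orP[/eqP|//]; rewrite -hq => eqx.
      by rewrite (injg' _ _ xE qE eqx) eqxx in xq.
    case: (cls _ xA) => [[w [wE _ ?]]|[_ [c' [d' [v' [_ vh' eqx _]]]]]]; first by exists w.
    by case: (Z x c' v' xE xA vh' eqx) => zx'; rewrite zx' in zx.
  have eql x : img g (x :\ z) = img h (x :\ z).
    by apply: eq_img => u; rewrite !inE => /andP[uz _]; apply: eqz.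
  have [cE dE cd zc zd] := tw.
  have eqc : c = p.
    apply: (link_inj (in2W injh) zc zp); apply: (fsetU1_inj (v := v)); try exact: img_range.
    by rewrite -eqp -eql vz -pendantE.
  subst c; rewrite (twin_uniq tw tw') in dB.
  by move: yB; rewrite -hq pendantE // -vz eql dB.
move=> nopen; apply: noteq.
have [b bE bA] : exists2 b, b \in E & forall x, x \in E -> x != b -> img g x \in A.
  case: (embeds_used emb) => [[b bE gb]|[_ gA]]; last by exists e => // x xE _; apply: gA.
  exists b => // x xE xb; have := emb.2 x xE; rewrite in_fset1U -gb => /orP[|//].
  by move/eqP/(injg' _ _ xE bE) => eqx; rewrite eqx eqxx in xb.
have [b' [b'E bb' ntw]] := not_twin_partner bE.
have [x xE xb xb'|_ ] := rigid_E (F := E) bE b'E bb' (subxx _) (in2W injh) (in2W injg).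
  case: (cls _ (bA x xE xb)) => [[w [wE _ ?]]|[_ pen]]; first by exists w.
  by case: nopen; exists x; split=> //; apply: bA.
exact.
Qed.

(** Both [a] and [y] belong to the copy [g]. Once blocked pendant edges are excluded from [g],
    rigidity makes [g] and [h] agree off [z]. As they differ on [e], the edges [a] and [y] must be
    the two pendant edges at the new vertex [g z], so answering [y] preserves the shape of the
    position. *)
Lemma blocked_threat h e A B a g (y : bedge) : blocked h e A B -> [disjoint A & B] ->
  a \notin A -> a \notin B -> y \notin B -> embeds g E (y |` (a |` A)) ->
  [/\ is_kedge k y, y \notin a |` A & blocked h e (a |` A) (y |` B)].
Proof.
move=> blk dis aA aB yB emb; have [injh eE hA heB cls] := blk.
have nt := blocked_no_threat blk dis.
have injg := inj_E emb; have injg' := img_inj emb.1.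
have disj x : x \in A -> x \notin B by apply/fdisjointP.
have yaA : y \notin a |` A.
  apply/negP => yaA; apply: (nt g a aB); apply: embedsS emb => x.
  by rewrite in_fset1U => /orP[/eqP->|].
have [ey eyE gy] : exists2 ey, ey \in E & img g ey = y.
  by case: (embeds_used emb) => // /(nt g a aB).
have [ea eaE ga] : exists2 ea, ea \in E & img g ea = a.
  have emb' : embeds g E (a |` (y |` A)) by rewrite fsetUCA.
  by case: (embeds_used emb') => // /(nt g y yB).
have [ya yA] : y != a /\ y \notin A by apply/andP; rewrite -negb_or -in_fset1U.
have eaey : ea != ey by apply: contraNneq ya => eqe; rewrite -gy -eqe ga.
have inA x : x \in E -> x != ea -> x != ey -> img g x \in A.
  move=> xE xea xey; have := emb.2 x xE; rewrite !in_fset1U -gy -ga.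
  by case/or3P => // /eqP/injg' eqx; [rewrite eqx ?eqxx in xey|rewrite eqx ?eqxx in xea].
have noteq : img g e != img h e.
  apply/eqP => eqe; have := emb.2 e eE; rewrite !in_fset1U eqe => /or3P[/eqP eqy|/eqP eqa|/disj].
  - by rewrite -eqy heB in yB.
  - by rewrite -eqa heB in aB.
  by rewrite heB.
have Z x c v : x \in E -> img g x \in A -> (forall u, v != h u) ->
    img g x = pendant h v c -> z \in x /\ v = g z.
  move=> xE xA vh eqx; have /imgP[u ux vu] : v \in img g x by rewrite eqx fset1U1.
  suff uz : u = z by rewrite -uz.
  (* Three edges, [y], [a] and [img g x], may pass through this vertex, so it takes the bound 4 of
     (ii) to conclude that it is [z]. *)
  apply: small_deg; apply: (deg_le_size (L := [:: y; a; img g x]) emb.1) => x' x'E ux'.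
  have vx' : v \in img g x' by rewrite vu mem_img.
  have := emb.2 x' x'E; rewrite !inE => /or3P[->|->|xA']; rewrite ?orbT //.
  apply/or3P; apply: Or33; apply/eqP; apply: (blocked_outside blk dis vh) => //.
  by rewrite eqx fset1U1.
case: (classic (exists p, [/\ p \in E, img g p \in A, z \in e
                            & blocked_pendant h B (img g p)])).
  move=> [p [pE pA ze [c [d [v [tw vh eqp dB]]]]]]; exfalso.
  have [zp vz] := Z p c v pE pA vh eqp.
  have [q tw'] := twin_partner pE zp; have [_ qE pq _ zq] := tw'.
  have qA : img g q \notin A.
    apply/negP => qA; have eqq : img g q = img g p.
      by apply: (blocked_outside blk dis vh); rewrite // vz mem_img.
    by rewrite (injg' _ _ qE pE eqq) eqxx in pq.
  have qB : img g q \notin B.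
    case: (eqVneq q ea) => [->|qea]; first by rewrite ga.
    case: (eqVneq q ey) => [->|qey]; first by rewrite gy.
    by rewrite inA in qA.
  (* One of [ea] and [ey] is [q]; [b] is the other one. *)
  have [b [bE bq bA bother]] : exists b, [/\ b \in E, b != q, img g b \notin A &
      forall x, x \in E -> x != b -> x != q -> img g x \in A].
    case: (eqVneq q ea) => [->|qea].
      exists ey; rewrite eq_sym gy; split=> // x xE xy xa; exact: inA.
    case: (eqVneq q ey) => [->|qey]; last by rewrite inA in qA.
    by exists ea; rewrite ga; split=> // x xE xy xa; apply: inA.
  have zb : z \notin b.
    apply/negP => zb; case: (twinP tw' bE zb) => eqb; first by rewrite -eqb (negPf bA) in pA.
    by rewrite eqb eqxx in bq.
  have cls' x : x \in Ez -> x != b -> exists w : {set V}, [/\ w \in E, w != e & img g x = img h w].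
    rewrite in_Ez => /andP[xE zx] xb.
    have xA : img g x \in A by apply: bother => //; apply: contraNneq zx => ->.
    case: (cls _ xA) => [//|[_ [c' [d' [v' [_ vh' eqx _]]]]]].
    by case: (Z x c' v' xE xA vh' eqx) => zx'; rewrite zx' in zx.
  (* A core vertex sent to [h z] would lie only on [b] and on the edge whose image is [img h w0],
     against degree 3 in [Ez]. *)
  have ghz u : u != z -> g u != h z.
    move=> uz; apply/eqP => gu; have [w0 tw0] := twin_partner eE ze.
    suff : deg Ez u <= 2 by rewrite leqNgt (deg_del uz).
    apply: (deg_le_size (L := [:: img g b; img h w0]) (in2W injg)) => x xEz ux; rewrite !inE.
    case: (eqVneq x b) => [->|xb]; first by rewrite eqxx.
    have [w [wE we eqw]] := cls' x xEz xb.
    have zw : z \in w by rewrite -(mem_img_inj (in2W injh) wE (hsupp_E z)) -eqw -gu mem_img.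
    by case: (twinP tw0 wE zw) => eqw'; rewrite eqw eqw' ?eqxx ?orbT // in we *.
  (* Moving [z] back to [h z] turns the pendant edge [p] into an edge of [h], so that rigidity
     applies with [b] and [q] removed. *)
  pose g' u := if u == z then h z else g u.
  have g'g u : u != z -> g' u = g u by rewrite /g' => /negPf->.
  have injg'' : injective g'.
    move=> u w; rewrite /g'; case: (eqVneq u z) => [->|uz]; case: (eqVneq w z) => [->|wz] //.
    - by move=> eqh; have := ghz w wz; rewrite eqh eqxx.
    - by move=> eqh; have := ghz u uz; rewrite eqh eqxx.
    exact: injg.
  have lg' x : img g' (x :\ z) = img g (x :\ z).
    by apply: eq_img => u; rewrite !inE => /andP[uz _]; apply: g'g.
  have vg x : v \notin img g (x :\ z).
    by apply: notin_img => u uz; rewrite vz (inj_eq injg) eq_sym.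
  have [cE dE cd zc zd] := tw.
  have lpc : img g (p :\ z) = img h (c :\ z).
    by apply: (fsetU1_inj (vg p) (img_range _ vh)); rewrite -eqp {1}vz -pendantE.
  have [x xE xb xq|eqz _] := rigid_E (F := E) bE qE bq (subxx _) (in2W injh) (in2W injg'').
    case: (boolP (z \in x)) => zx.
      case: (twinP tw' xE zx) => eqx; last by rewrite eqx eqxx in xq.
      by exists c => //; rewrite eqx (pendantE _ zp) (pendantE _ zc) lg' lpc /g' eqxx.
    have [|w [wE _ eqw]] := cls' x _ xb; first by rewrite in_Ez xE.
    exists w; rewrite // -eqw; apply: eq_img => u ux; apply: g'g.
    by apply: contraNneq zx => <-.
  have eql x : img g (x :\ z) = img h (x :\ z).
    by apply: eq_img => u; rewrite !inE => /andP[uz _]; rewrite -eqz // g'g.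
  have eqc : c = p by apply: (link_inj (in2W injh) zc zp); rewrite -lpc eql.
  subst c; rewrite (twin_uniq tw tw') in dB.
  by move: qB; rewrite pendantE // -vz eql dB.
move=> nopen; split=> //; first by rewrite /is_kedge -gy card_img ?E_unif //; apply: in2W.
have [x xE xa xy|eqz eqtw] := rigid_E (F := E) eaE eyE eaey (subxx _) (in2W injh) (in2W injg).
  have xA := inA x xE xa xy.
  case: (cls _ xA) => [[w [wE _ ?]]|[ze pen]]; first by exists w.
  by case: nopen; exists x.
have ze : z \in e.
  apply: contraNT noteq => ze; apply/eqP/eq_img => u ue; apply: eqz.
  by apply: contraNneq ze => <-.
have ngh : ~ g =1 h by move=> gh; case/eqP: noteq; apply: eq_img => u _; apply: gh.
have tw : twin ea ey by case: (classic (twin ea ey)) => // /eqtw/ngh.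
have vh u : g z != h u.
  case: (eqVneq u z) => [->|uz]; last by rewrite -eqz // (inj_eq injg) eq_sym.
  apply/eqP => gz; apply: ngh => w; case: (eqVneq w z) => [->//|]; exact: eqz.
have eql x : img g (x :\ z) = img h (x :\ z).
  by apply: eq_img => u; rewrite !inE => /andP[uz _]; apply: eqz.
have [_ _ _ zea zey] := tw.
split=> // [x xE xe||x].
- by rewrite in_fset1U hA ?orbT.
- by rewrite in_fset1U heB orbT.
rewrite in_fset1U => /orP[/eqP->|/cls[|[_ [c [d [v [tw' vh' eqx dB]]]]]]]; [right|by left|right].
  split=> //; exists ea, ey, (g z); split=> //; first by rewrite -eql -pendantE.
  by rewrite -eql -pendantE // gy fset1U1.
by split=> //; exists c, d, v; rewrite in_fset1U dB orbT.
Qed.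

(** A vertex outside [h] lies on at most one edge of [A], besides possibly [a]; this is below the
    degree 3 of a core vertex. *)
Lemma blocked_core_range h e A B a g u : blocked h e A B -> [disjoint A & B] ->
  embeds g Ez (a |` A) -> u != z -> exists w, g u = h w.
Proof.
move=> blk dis emb uz; apply: NNPP => nex.
have vh w : g u != h w by apply/eqP => eqv; apply: nex; exists w.
suff : deg Ez u <= 2 by rewrite leqNgt (deg_del uz).
have [P PA] : exists P : bedge, forall x, x \in A -> g u \in x -> x = P.
  case: (classic (exists2 P, P \in A & g u \in P)) => [[P PA uP]|nP].
    by exists P => x xA ux; apply: (blocked_outside blk dis vh).
  by exists fset0 => x xA ux; case: nP; exists x.
apply: (deg_le_size (L := [:: a; P]) emb.1) => x xEz ux.
have := emb.2 x xEz; rewrite !inE => /orP[->//|/PA->]; rewrite ?eqxx ?orbT //.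
exact: mem_img.
Qed.

(** * Choosing the roles of [r] and [g] *)

Lemma not_pinned f c d A : ~ pinned f c d A -> exists h c' d', [/\ twin c' d',
  embeds h Ez A, img h (c' :\ z) = img f (d :\ z) & img h (d' :\ z) <> img f (c :\ z)].
Proof.
move=> npin; apply: NNPP => nex; apply: npin => h c' d' tw emb eqd.
by apply: NNPP => neq; apply: nex; exists h, c', d'.
Qed.

(* By (vi), [(r :|: g) :\ z] has more vertices than [~: p], so the links of [z] in the
   core of [f] cannot both lie in the vertex set of [h] and avoid [img h p]. *)
Lemma blocked_pinned h e A B a f p r g : blocked h e A B -> [disjoint A & B] ->
  {in predC1 z &, injective f} -> p \in E -> (forall u, u != z -> f u \notin img h p) ->
  twin r g -> pinned f r g (a |` A) \/ pinned f g r (a |` A).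
Proof.
move=> blk dis injf pE fp tw; apply: NNPP => /not_or_and[].
move=> /not_pinned[h1 [c1 [d1 [_ emb1 eq1 _]]]] /not_pinned[h2 [c2 [d2 [_ emb2 eq2 _]]]].
have [rE gE rg zr zg] := tw; have [injh _ _ _ _] := blk.
have sub : {subset map f (enum ((r :|: g) :\ z)) <= map h (enum (~: p))}.
  move=> x /mapP[u]; rewrite mem_enum !inE => /andP[uz urg] ->.
  (* Failure of one choice of roles puts the link of [g] inside a core of the opponent, failure of
     the other puts the link of [r] there. *)
  have [w fw] : exists w, f u = h w.
    have from h' c' d' : embeds h' Ez (a |` A) -> img h' (c' :\ z) = img f (d' :\ z) ->
        u \in d' -> exists w, f u = h w.
      move=> emb eqi ud; have /imgP[u' u'c ->] : f u \in img h' (c' :\ z).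
        by rewrite eqi mem_img // !inE uz.
      by move: u'c; rewrite !inE => /andP[u'z _]; apply: (blocked_core_range blk dis emb).
    by case/orP: urg; [apply: from emb2 eq2|apply: from emb1 eq1].
  rewrite fw map_f // mem_enum inE; apply: contraNN (fp u uz) => wp.
  by rewrite fw mem_img.
have /uniq_leq_size/(_ sub) : uniq (map f (enum ((r :|: g) :\ z))).
  rewrite map_inj_in_uniq ?enum_uniq // => u w; rewrite !mem_enum !inE.
  by move=> /andP[uz _] /andP[wz _]; apply: injf.
rewrite !size_map -!cardE; have := small_rg rE gE rg zr zg.
have := cardsC p; rewrite E_unif //; have := cardsC (r :|: g).
rewrite (cardsD1 z (r :|: g)) inE zr /=.
move: #|~: p| #|~: _| #|_ :\ z| #|V| => n1 n2 n3 n4; clear -k_ge2; lia.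
Qed.

(** If both choices fail, there are two badly placed cores in [A]. Both avoid [e1], so both use up
    the remaining [#|Ez|] edges, and by (iv) they agree off [z]. Their links then match those of [f]
    in a way that one failure forbids, or identify [r] with [g]. *)
Lemma first_moves_pinned f r g A (e1 : bedge) : twin r g -> {in predC1 z &, injective f} ->
  e1 \in A -> #|` A| = #|Ez|.+1 -> (forall u, u != z -> f u \notin e1) ->
  pinned f r g A \/ pinned f g r A.
Proof.
move=> tw injf e1A cA fe1; apply: NNPP => /not_or_and[].
move=> /not_pinned[h1 [c1 [d1 [tw1 emb1 eq1 ne1]]]].
move=> /not_pinned[h2 [c2 [d2 [tw2 emb2 eq2 ne2]]]].
have [rE gE rg zr zg] := tw.
(* By (v) every core edge meets the link [c], whose image consists of vertices of [f]; these miss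
   [e1], so no core edge is sent to [e1]. *)
have avoid h c d c' : twin c d -> embeds h Ez A ->
    img h (c :\ z) = img f (c' :\ z) -> embeds h Ez (A `\ e1).
  move=> [cE dE cd zc zd] emb eqi; split=> [|x xEz]; first exact: emb.1.
  rewrite in_fsetD1 emb.2 // andbT; apply/eqP => hx.
  move: (xEz); rewrite in_Ez => /andP[xE zx].
  have [/set0Pn[u /setIP[ux uc]] _] := meet_rg cE dE cd zc zd xE.
  have uz : u != z by apply: contraNneq zx => <-.
  have /imgP[w wc' hw] : h u \in img f (c' :\ z) by rewrite -eqi mem_img // !inE uz.
  move: wc'; rewrite !inE => /andP[wz _]; move: (fe1 w wz).
  by rewrite -hw -hx mem_img.
have em1 := avoid _ _ _ _ tw1 emb1 eq1; have em2 := avoid _ _ _ _ tw2 emb2 eq2.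
have cA1 : #|` A `\ e1| <= #|Ez| by have := cardfsD1 e1 A; rewrite e1A cA; lia.
have onto := embeds_onto em1 cA1.
have eqh u : u != z -> h2 u = h1 u.
  have injD : {in hsupport (E :\: [set r; g]) &, injective h2} by rewrite -(EzD tw); case: emb2.
  move: u; have [x xE xr xg|eqz _] := rigid_E rE gE rg subEz emb1.1 injD; last exact: eqz.
  by apply/onto/em2.2; rewrite (EzD tw) !inE negb_or xr xg.
have eql x : img h2 (x :\ z) = img h1 (x :\ z).
  by apply: eq_img => u; rewrite !inE => /andP[uz _]; apply: eqh.
have [c1E _ _ zc1 _] := tw1; have [c2E _ _ zc2 _] := tw2.
case: (twinP tw1 c2E zc2) => eqc; last by apply: ne1; rewrite -eqc -eql eq2.
case/eqP: rg; apply: (link_inj injf zr zg).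
by rewrite -eq1 -eq2 eqc eql.
Qed.

(** * From the completed core to the forcing phase *)

(** Here [img h p] is the opponent's first edge, which has become part of his blocked copy. *)
Definition tracking (A B : {fset bedge}) : Prop := exists f h e p,
  [/\ embeds f Ez B, blocked h e A B, p \in E & forall u, u != z -> f u \notin img h p].

Lemma tracking_step A B a : tracking A B -> [disjoint A & B] -> a \notin A -> a \notin B ->
  exists b, [/\ is_kedge k b, b \notin a |` A, b \notin B &
    tracking (a |` A) (b |` B) \/ forcing (a |` A) (b |` B)].
Proof.
move=> [f [h [e [p [emf blk pE fp]]]]] dis aA aB.
case: (classic (no_threat (a |` A) B)) => [nt|].
  have [r [g tw]] := exists_twin.
  case: (blocked_pinned a blk dis (inj_Ez emf) pE fp tw) => pin.
    by have [b [kb bA bB fo]] := forcing_start tw emf nt pin; exists b; split=> //; right.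
  have [b [kb bA bB fo]] := forcing_start (twinC tw) emf nt pin.
  by exists b; split=> //; right.
move=> th; have [g [y [yB emb]]] : exists g y, y \notin B /\ embeds g E (y |` (a |` A)).
  apply: NNPP => nex; apply: th => g y yB emb; apply: nex; by exists g, y.
have [ky yA blk'] := blocked_threat blk dis aA aB yB emb.
exists y; split=> //; left; exists f, h, e, p; split=> //.
by apply: embedsS emf => x xB; rewrite in_fset1U xB orbT.
Qed.

Definition core_built (A B : {fset bedge}) : Prop := exists f (e1 : bedge),
  [/\ embeds f Ez B, e1 \in A, #|` A| = #|Ez| & forall u, u != z -> f u \notin e1].

(** After [a] the opponent has [#|E| - 1] edges, so a threat uses all of them: blocking it gives a
    position [blocked] with no pendant edges yet. *)
Lemma core_built_step A B a : core_built A B -> [disjoint A & B] -> a \notin A -> a \notin B ->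
  exists b, [/\ is_kedge k b, b \notin a |` A, b \notin B &
    tracking (a |` A) (b |` B) \/ forcing (a |` A) (b |` B)].
Proof.
move=> [f [e1 [emf e1A cA fe1]]] dis aA aB.
have caA : #|` a |` A| = #|Ez|.+1 by rewrite cardfsU1 aA cA.
have e1aA : e1 \in a |` A by rewrite in_fset1U e1A orbT.
case: (classic (no_threat (a |` A) B)) => [nt|].
  have [r [g tw]] := exists_twin.
  case: (first_moves_pinned tw (inj_Ez emf) e1aA caA fe1) => pin.
    by have [b [kb bA bB fo]] := forcing_start tw emf nt pin; exists b; split=> //; right.
  have [b [kb bA bB fo]] := forcing_start (twinC tw) emf nt pin.
  by exists b; split=> //; right.
move=> th; have [g [y [yB emb]]] : exists g y, y \notin B /\ embeds g E (y |` (a |` A)).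
  apply: NNPP => nex; apply: th => g y yB emb; apply: nex; by exists g, y.
have injg := inj_E emb; have injg' := img_inj emb.1.
have yaA : y \notin a |` A.
  apply/negP => yaA; have /embeds_card : embeds g E (a |` A).
    by apply: embedsS emb => x; rewrite in_fset1U => /orP[/eqP->|].
  by rewrite caA -card_Ez ltnn.
have onto x : x \in y |` (a |` A) -> exists2 e, e \in E & x = img g e.
  by apply: (embeds_onto emb); rewrite cardfsU1 yaA caA -card_Ez.
have [e eE ye] := onto y (fset1U1 _ _).
have [p pE e1p] := onto e1 (fset1Ur _ e1aA).
exists y; split=> //; first by rewrite /is_kedge ye card_img ?E_unif //; apply: in2W.
left; exists f, g, e, p; split=> //.
- by apply: embedsS emf => x xB; rewrite in_fset1U xB orbT.
- split=> // [x xE xe||x xA].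
  + have := emb.2 x xE; rewrite in_fset1U ye => /orP[/eqP/(injg' _ _ xE eE) eqx|//].
    by rewrite eqx eqxx in xe.
  + by rewrite -ye fset1U1.
  left; have [w wE eqw] := onto x (fset1Ur _ xA); exists w; split=> //.
  by apply: contraNneq yaA => we; rewrite ye -we -eqw.
by rewrite -e1p.
Qed.

(** * Building the core by a simulated fast game *)

Definition shift N (y : bedge) : bedge := [fset (N + v)%N | v in y].

Lemma shift_inj N : injective (shift N).
Proof.
have sub x y : shift N x = shift N y -> {subset x <= y}.
  move=> eqs v vx; have : (N + v)%N \in shift N y by rewrite -eqs; apply/imfsetP; exists v.
  by case/imfsetP => w wy /addnI->.
by move=> x y eqs; apply/fsetP => v; apply/idP/idP; apply: sub.
Qed.

Lemma kedge_shift N y : is_kedge k (shift N y) = is_kedge k y.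
Proof. by rewrite /is_kedge card_imfset //; apply: addnI. Qed.

Lemma shift_above N y (S : {fset bedge}) : is_kedge k y ->
  (forall x v, x \in S -> v \in x -> v < N) -> shift N y \notin S.
Proof.
move=> /eqP ky bS; apply/negP => yS.
have /fset0Pn[v vy] : y != fset0 by rewrite -cardfs_gt0 ky; apply: ltnW.
have := bS _ (N + v)%N yS; rewrite ltnNge leq_addr => /implyP.
by rewrite implybF => /negP[]; apply/imfsetP; exists v.
Qed.

(* The core is built above [N], hence off the opponent's first edge [e1], by simulating a
   game [l] on [nat], shifted by [N]; opponent moves without a counterpart in that game are
   replaced there by arbitrary free edges. *)
Definition building (s : strategy) (A B : {fset bedge}) : Prop :=
  exists N l (e1 : bedge), [/\ legal_hist k l,
    forall i, i < size l -> ~~ odd i -> nth fset0 l i = s (take i l),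
    e1 \in A /\ forall v, v \in e1 -> v < N,
    forall y, is_kedge k y -> shift N y \in A `|` B -> y \in l &
    [/\ forall y, y \in side false l -> shift N y \in B, odd (size l),
        size l < 2 * #|Ez| & #|` A|.*2 = (size l).+1]].

Lemma building_start s B (e1 : bedge) : strategy_legal k false s -> e1 \notin B ->
  exists b, [/\ is_kedge k b, b \notin e1 |` fset0, b \notin B &
    building s (e1 |` fset0) (b |` B)].
Proof.
(* [N] also exceeds the edges of [B], which is nonempty if the drawing player moved first; such
   edges have no counterpart in the simulated game. *)
move=> legs e1B; have [N bN] := fset_bound (e1 |` B).
have /andP[kd _] : legal_move k [::] (s [::]) by apply: legs.
have dB : shift N (s [::]) \notin e1 |` B by apply: shift_above bN.
move: (dB); rewrite in_fset1U negb_or => /andP[de1 dB'].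
exists (shift N (s [::])); split; rewrite ?kedge_shift ?fsetU0 ?inE //.
exists N, [:: s [::]], e1; split.
- by apply: (legal_hist_rcons (l := [::])); [move=> i | rewrite /legal_move kd].
- by case.
- by split; [rewrite fset11 | move=> v; apply: bN; rewrite fset1U1].
- move=> y ky; rewrite !in_fsetU !in_fset1 orbCA => /orP[/eqP/shift_inj->|ye1B].
    exact: mem_head.
  by have := shift_above ky bN; rewrite in_fset1U ye1B.
split=> // [y /sideP[[|i] [] // _ _ <-]||]; first by rewrite fset1U1.
  have [x xEz] := Ez_neq0; have Ez0 : 0 < #|Ez| by apply/card_gt0P; exists x.
  by rewrite mul2n -addnn; apply: (leq_add Ez0 Ez0).
by rewrite cardfs1.
Qed.

Lemma building_core s A B :
  (forall l, legal_hist k l ->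
    (forall i, i < size l -> ~~ odd i -> nth fset0 l i = s (take i l)) ->
    (size l).+1 = 2 * #|Ez| -> exists f, embeds f Ez (side false l)) ->
  building s A B -> #|Ez| <= #|` A| -> core_built A B.
Proof.
move=> win [N [l [e1 [ll con [e1A e1N] _ [lB ol sl cA]]]]] leA.
have sl' : (size l).+1 = 2 * #|Ez|.
  by apply/eqP; rewrite eqn_leq sl -cA mul2n leq_double.
have [f emf] := win l ll con sl'.
exists (fun u => (N + f u)%N), e1; split=> // [|| u _].
- split=> [u w uE wE /addnI|e eE]; first exact: emf.1.
  have -> : img (fun u => (N + f u)%N) e = shift N (img f e).
    apply/fsetP => v; apply/imgP/imfsetP => -[x xe ->].
      by exists (f x); rewrite //= mem_img.
    by case/imgP: xe => u ue ->; exists u.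
  by apply: lB; apply: emf.2.
- by apply: double_inj; rewrite cA sl' mul2n.
by apply/negP => /e1N; rewrite ltnNge leq_addr.
Qed.

Lemma building_step s A B a : strategy_legal k false s ->
  building s A B -> #|` A| < #|Ez| -> a \notin A -> a \notin B ->
  exists b, [/\ is_kedge k b, b \notin a |` A, b \notin B & building s (a |` A) (b |` B)].
Proof.
move=> legs [N [l [e1 [ll con [e1A e1N] AB [lB ol sl cA]]]]] ltA aA aB.
(* The simulated opponent move [o] is the preimage of [a] if that is a free edge, and any free edge
   otherwise. The second case includes a preimage already in [l], put there earlier as a
   replacement. *)
have [o [ko ol' oa]] : exists o, [/\ is_kedge k o, o \notin l &
    forall y, is_kedge k y -> shift N y = a -> y \in rcons l o].
  case: (classic (exists y, [/\ is_kedge k y, y \notin l & shift N y = a])).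
    move=> [o [ko ol' oa]]; exists o; split=> // y _; rewrite -oa => /shift_inj->.
    by rewrite mem_rcons mem_head.
  move=> none; have [o ko] := fresh_edge [fset x in l] (ltnW k_ge2).
  rewrite inE => ol'; exists o; split=> // y ky ya; rewrite mem_rcons inE orbC.
  case: (boolP (y \in l)) => // yl; by case: none; exists y.
have lo : legal_hist k (rcons l o) by apply: legal_hist_rcons; rewrite // /legal_move ko.
have /andP[kd dl] : legal_move k (rcons l o) (s (rcons l o)).
  by apply: legs; rewrite // size_rcons /= ol.
set d := s (rcons l o) in kd dl *.
(* Each claimed edge that is a shift has its preimage in the simulated history, so a legal simulated
   answer is legal on the board. *)
have dnew : shift N d \notin (a |` A) `|` B.
  apply: contraNN dl; rewrite -fsetUA in_fset1U => /orP[/eqP|/(AB _ kd)]; first exact: oa.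
  by rewrite mem_rcons inE => ->; rewrite orbT.
move: (dnew); rewrite in_fsetU negb_or => /andP[daA dB].
exists (shift N d); rewrite kedge_shift; split=> //.
exists N, (rcons (rcons l o) d), e1; split.
- by apply: legal_hist_rcons; rewrite // /legal_move kd.
- move=> i; rewrite !size_rcons !ltnS !nth_rcons !size_rcons => il oi.
  rewrite ltnS; case: (ltngtP i (size l)) => [il'|il'|il'].
  + by rewrite con // -!cats1 -catA takel_cat // ltnW.
  + have -> : i = (size l).+1 by apply/eqP; rewrite eqn_leq il il'.
    by rewrite eqxx -(cats1 (rcons l o)) take_size_cat ?size_rcons.
  by rewrite il' ol in oi.
- by split=> //; rewrite in_fset1U e1A orbT.
- move=> y ky; rewrite in_fsetU !in_fset1U -orbA => /or4P[/eqP/(oa _ ky) yo|yA|/eqP/shift_inj->|yB].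
  + by rewrite mem_rcons inE yo orbT.
  + by rewrite !(mem_rcons, inE) AB ?orbT // in_fsetU yA.
  + by rewrite mem_rcons mem_head.
  by rewrite !(mem_rcons, inE) AB ?orbT // in_fsetU yB orbT.
rewrite !side_rcons !size_rcons /= ol /=; split=> // [y||].
- rewrite in_fset1U => /orP[/eqP->|/lB yB]; first by rewrite fset1U1.
  by rewrite in_fset1U yB orbT.
- by rewrite -cA mul2n -doubleS leq_double.
by rewrite cardfsU1 aA add1n doubleS cA.
Qed.

(** * The invariant of the whole game *)

Lemma small_no_copy A a : a \notin A -> #|` A| <= #|Ez| ->
  ~ exists f, embeds f E (a |` A).
Proof.
move=> aA cA [f /embeds_card]; rewrite cardfsU1 aA -card_Ez add1n !ltnS => lt.
by have := leq_trans lt cA; rewrite ltnn.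
Qed.

Lemma strong_draw : strong_game_draw k E.
Proof.
have [s [legs win]] := fast_winning_finite (ltnW k_ge2) fast.
(* The phases in order of play; in the last alternative the drawing player owns a copy and any move
   will do. The position [core_built] is only passed through: it is derived from [building] when [A]
   reaches [#|Ez|] edges. *)
pose Inv A B := [\/ A = fset0, building s A B, tracking A B |
  forcing A B \/ exists f, embeds f E B].
have Enz : E != set0 by have [r [_ [rE _ _ _ _]]] := exists_twin; apply/set0Pn; exists r.
apply: (draw_of_invariant (Inv := Inv)) => //; first exact: ltnW.
- by move=> B; apply: Or41.
- move=> A B a [A0|bu|tr|[fo|[f emf]]] dis ka aA aB.
  + by subst A; have [b [kb bA bB ?]] := building_start legs aB; exists b; split=> //; apply: Or42.
  + case: (ltnP #|` A| #|Ez|) => cA.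
      have [b [kb bA bB ?]] := building_step legs bu cA aA aB.
      by exists b; split=> //; apply: Or42.
    have [b [kb bA bB st]] := core_built_step (building_core win bu cA) dis aA aB;
      by exists b; split=> //; case: st; [apply: Or43|move=> ?; apply: Or44; left].
  + have [b [kb bA bB st]] := tracking_step tr dis aA aB;
      by exists b; split=> //; case: st; [apply: Or43|move=> ?; apply: Or44; left].
  + have [b [kb bA bB st]] := forcing_step fo aA aB;
      by exists b; split=> //; apply: Or44.
  have [b kb] := fresh_edge ((a |` A) `|` B) (ltnW k_ge2).
  rewrite in_fsetU negb_or => /andP[bA bB]; exists b; split=> //; apply: Or44; right; exists f.
  by apply: embedsS emf => x xB; rewrite in_fset1U xB orbT.
move=> A B a [A0|bu|tr|[fo|//]] dis aA aB ex.
- by case: (small_no_copy aA _ ex); rewrite A0 cardfs0.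
- case: (small_no_copy aA _ ex); have [N [l [e1 [_ _ _ _ [_ _ sl cA]]]]] := bu.
  by rewrite -leq_double cA -mul2n.
- have [f [h [e [p [_ blk _ _]]]]] := tr; have [g emg] := ex.
  by case: (blocked_no_threat blk dis aB emg).
have [f [c [d [v [_ _ nt _ _]]]]] := fo; have [g emg] := ex.
by case: (nt g a aB emg).
Qed.

End Draw.

Theorem theorem3p1 (k : nat) (V : finType) (E : {set {set V}}) (z : V) :
  2 <= k ->
  (forall e, e \in E -> #|e| = k) ->
  (* (i) *)
  deg E z = 2 ->
  (* (ii) *)
  (forall u, u != z -> 3 <= deg (del_vertex E z) u) ->
  (forall u, u != z -> 4 <= deg E u) ->
  (* (iii) *)
  fast_winning k (del_vertex E z) ->
  (* (iv) *)
  (forall e e', e \in E -> e' \in E -> e != e' ->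
     forall phi : V -> V, hyp_monomorphism (E :\: [set e; e']) E phi ->
       {in hsupport (E :\: [set e; e']), forall a, phi a = a}) ->
  (* (v) *)
  (forall r g, r \in E -> g \in E -> r != g -> z \in r -> z \in g ->
     forall e, e \in E -> e :&: r != set0 /\ e :&: g != set0) ->
  (* (vi) *)
  (forall r g, r \in E -> g \in E -> r != g -> z \in r -> z \in g ->
     #|~: (r :|: g)| < k.-1) ->
  strong_game_draw k E.
Proof.
move=> k2 unif dz ddel dE fast mono meet small.
exact: strong_draw k2 unif dz ddel dE fast mono meet small.
Qed.
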